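(* Let $k$ be a field of characteristic zero, let $q\in k^\times$ be transcendental over $\mathbb{Q}$, and let $n$ be a positive integer. For $i=1,\dots,n$ let $\tau_i=\sum_I q^{-2w(I)}[I|I]\in\mathcal{O}_q(M_n(k))$, where $I$ runs through all $i$-element subsets of $\{1,\dots,n\}$ and $w(I)$ is the sum of the entries of $I$. Then the subalgebra $k[\tau_1,\dots,\tau_n]$ of $\mathcal{O}_q(M_n(k))$ generated by $\tau_1,\dots,\tau_n$ is a commutative polynomial algebra in the $n$ indeterminates $\tau_1,\dots,\tau_n$; that is, the $\tau_i$ commute pairwise and are algebraically independent over $k$.
   Context: $\mathcal{O}_q(M_n(k))$ is the standard single-parameter quantized coordinate ring of $n\times n$ matrices: the $k$-algebra with generators $X_{ij}$ ($1\le i,j\le n$) and relations $X_{ij}X_{il}=qX_{il}X_{ij}$ for $j<l$; $X_{ij}X_{lj}=qX_{lj}X_{ij}$ for $i<l$; $X_{ij}X_{lm}=X_{lm}X_{ij}$ for $i<l$ and $j>m$; $X_{ij}X_{lm}-X_{lm}X_{ij}=(q-q^{-1})X_{im}X_{lj}$ for $i<l$ and $j<m$. For subsets $I=\{i_1<\dots<i_t\}$ and $J=\{j_1<\dots<j_t\}$ of $\{1,\dots,n\}$ of the same size, the quantum minor $[I|J]$ is the quantum determinant of the quantum matrix subalgebra generated by the $X_{ij}$ with $i\in I$, $j\in J$, namely $[I|J]=\sum_{\pi\in S_t}(-q)^{\ell(\pi)}X_{i_1,j_{\pi(1)}}\cdots X_{i_t,j_{\pi(t)}}$, where $\ell(\pi)$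 is the length of $\pi$. *)

(* Defs.v *)
From HB Require Import structures.
From mathcomp Require Import all_boot all_order perm all_algebra.
From mathcomp Require boolp.
From mathcomp Require monalg mpoly.

Set Implicit Arguments.
Unset Strict Implicit.
Unset Printing Implicit Defensive.

Import GRing.Theory.
Local Open Scope ring_scope.
Local Open Scope quotient_scope.

(* Two-sided ideal generated by S. In a unital k-algebra it is automatically
   stable under scalars, so this is also the ideal of the algebra. *)
Inductive ideal_gen (A : nzRingType) (S : A -> Prop) : A -> Prop :=
| ideal_gen0 : ideal_gen S 0
| ideal_genD x y : ideal_gen S x -> ideal_gen S y -> ideal_gen S (x + y)
| ideal_genM a r b : S r -> ideal_gen S (a * r * b).

Inductive subalg_gen (k : nzRingType) (A : algType k) (S : A -> Prop) :
  A -> Prop :=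
| subalg_gen_in a : S a -> subalg_gen S a
| subalg_gen_scalar c : subalg_gen S c%:A
| subalg_genD a b : subalg_gen S a -> subalg_gen S b -> subalg_gen S (a + b)
| subalg_genM a b : subalg_gen S a -> subalg_gen S b -> subalg_gen S (a * b).

Section QuantumMatrices.
(* Imported here only: monalg and mpoly both define {mpoly R[n]}. *)
Import monalg.
Variables (k : fieldType) (n : nat) (q : k).

Definition free_alg : lalgType k := {malg k[{fmonom ('I_n * 'I_n)%type}]}.

Definition free_gen (i j : 'I_n) : free_alg := << fmu (i, j) >>.

Local Notation F := free_alg.
Local Notation x := free_gen.

Inductive qmat_rel : F -> Prop :=
| qmat_row (i j l : 'I_n) : (j < l)%N ->
    qmat_rel (x i j * x i l - q *: (x i l * x i j))
| qmat_col (i l j : 'I_n) : (i < l)%N ->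
    qmat_rel (x i j * x l j - q *: (x l j * x i j))
| qmat_comm (i j l m : 'I_n) : (i < l)%N -> (m < j)%N ->
    qmat_rel (x i j * x l m - x l m * x i j)
| qmat_cross (i j l m : 'I_n) : (i < l)%N -> (j < m)%N ->
    qmat_rel (x i j * x l m - x l m * x i j
              - (q - q^-1) *: (x i m * x l j)).

Definition qmat_ideal : {pred F} :=
  fun a => boolp.asbool (ideal_gen qmat_rel a).

Lemma qmat_idealP a : reflect (ideal_gen qmat_rel a) (a \in qmat_ideal).
Proof. exact: boolp.asboolP. Qed.

Lemma qmat_ideal_mull c a : a \in qmat_ideal -> c * a \in qmat_ideal.
Proof.
move/qmat_idealP=> ia; apply/qmat_idealP.
elim: ia => [|u v _ iu _ iv|b r d Sr].
- by rewrite mulr0; apply: ideal_gen0.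
- by rewrite mulrDr; apply: ideal_genD.
- by rewrite !mulrA; apply: ideal_genM.
Qed.

Lemma qmat_ideal_mulr c a : a \in qmat_ideal -> a * c \in qmat_ideal.
Proof.
move/qmat_idealP=> ia; apply/qmat_idealP.
elim: ia => [|u v _ iu _ iv|b r d Sr].
- by rewrite mul0r; apply: ideal_gen0.
- by rewrite mulrDl; apply: ideal_genD.
- by rewrite -(mulrA (b * r)); apply: ideal_genM.
Qed.

Lemma qmat_ideal_zmod_closed : zmod_closed qmat_ideal.
Proof.
split=> [|a b ia ib].
  by apply/qmat_idealP; apply: ideal_gen0.
apply/qmat_idealP/ideal_genD; first exact/qmat_idealP.
rewrite -[- b]mulN1r.
by apply/qmat_idealP; exact: qmat_ideal_mull.
Qed.

HB.instance Definition _ :=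
  GRing.isZmodClosed.Build F qmat_ideal qmat_ideal_zmod_closed.

(* Every relation has zero constant term, so the quotient is nontrivial. *)
Lemma qmat_ideal1 : 1 \notin qmat_ideal.
Proof.
pose e : F -> k := @mcoeff {fmonom ('I_n * 'I_n)%type} k mone.
have e1 : e 1 = 1 by exact: rmorph1.
have eD : {morph e : a b / a + b} by exact: raddfD.
have eB : {morph e : a b / a - b} by exact: raddfB.
have eM : {morph e : a b / a * b} by exact: rmorphM.
have eZ c a : e (c *: a) = c * e a by exact: mcoeffZ.
have ex i j : e (x i j) = 0.
  rewrite /e mcoeffU; case: eqP => // /(congr1 (@fdeg _)).
  by rewrite fdegU fdeg1.
have exx i j l m : e (x i j * x l m) = 0 by rewrite eM ex mul0r.
have e0B a b : e a = 0 -> e b = 0 -> e (a - b) = 0.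
  by move=> ea eb; rewrite eB ea eb subr0.
have e0Z c a : e a = 0 -> e (c *: a) = 0 by move=> ea; rewrite eZ ea mulr0.
have er r : qmat_rel r -> e r = 0.
  case=> [i j l _|i l j _|i j l m _ _|i j l m _ _].
  - by apply: e0B (exx _ _ _ _) (e0Z _ _ (exx _ _ _ _)).
  - by apply: e0B (exx _ _ _ _) (e0Z _ _ (exx _ _ _ _)).
  - by apply: e0B (exx _ _ _ _) (exx _ _ _ _).
  - by apply: e0B (e0B _ _ (exx _ _ _ _) (exx _ _ _ _)) (e0Z _ _ (exx _ _ _ _)).
have eI a : ideal_gen qmat_rel a -> e a = 0.
  elim=> [|u v _ iu _ iv|b r d Sr]; first by rewrite -(subrr 1) eB subrr.
    by rewrite eD iu iv addr0.
  by rewrite !eM (er _ Sr) mulr0 mul0r.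
by apply/qmat_idealP => /eI/eqP; rewrite e1 oner_eq0.
Qed.

(* O_q(M_n(k)) *)
Definition Oq : Type := Quotient.quot qmat_ideal.
HB.instance Definition _ := GRing.Zmodule.on Oq.

Local Notation pi := (\pi_(Quotient.quot qmat_ideal)).

Definition Oq_one : Oq := pi 1.
Definition Oq_mul (a b : Oq) : Oq := pi (repr a * repr b).
Definition Oq_scale (c : k) (a : Oq) : Oq := pi (c *: repr a).

Lemma Oq_piP a b : reflect (pi a = pi b) (a - b \in qmat_ideal).
Proof. by rewrite Quotient.idealrBE; apply: eqP. Qed.

Lemma Oq_repr a : repr (pi a) - a \in qmat_ideal.
Proof. by apply/Oq_piP; rewrite reprK. Qed.

Lemma Oq_piD a b : pi (a + b) = (pi a : Oq) + pi b.
Proof. by rewrite !piE. Qed.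

Lemma Oq_piM a b : Oq_mul (pi a) (pi b) = pi (a * b).
Proof.
apply/Oq_piP; set a' := repr _; set b' := repr _.
have -> : a' * b' - a * b = (a' - a) * b' + a * (b' - b).
  by rewrite mulrBl mulrBr addrA subrK.
apply: rpredD; [apply: qmat_ideal_mulr | apply: qmat_ideal_mull];
  exact: Oq_repr.
Qed.

Lemma Oq_piZ c a : Oq_scale c (pi a) = pi (c *: a).
Proof.
apply/Oq_piP; rewrite -scalerBr -[_ - _]mul1r scalerAl.
by rewrite qmat_ideal_mull ?Oq_repr.
Qed.

Lemma Oq_ind (P : Oq -> Prop) : (forall a, P (pi a)) -> forall a, P a.
Proof. by move=> Ppi a; rewrite -[a]reprK. Qed.

Lemma Oq_mulA : associative Oq_mul.
Proof.
by elim/Oq_ind=> a; elim/Oq_ind=> b; elim/Oq_ind=> c; rewrite !Oq_piM mulrA.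
Qed.

Lemma Oq_mul1r : left_id Oq_one Oq_mul.
Proof. by elim/Oq_ind=> a; rewrite Oq_piM mul1r. Qed.

Lemma Oq_mulr1 : right_id Oq_one Oq_mul.
Proof. by elim/Oq_ind=> a; rewrite Oq_piM mulr1. Qed.

Lemma Oq_mulDl : left_distributive Oq_mul +%R.
Proof.
elim/Oq_ind=> a; elim/Oq_ind=> b; elim/Oq_ind=> c.
by rewrite -Oq_piD !Oq_piM -Oq_piD mulrDl.
Qed.

Lemma Oq_mulDr : right_distributive Oq_mul +%R.
Proof.
elim/Oq_ind=> a; elim/Oq_ind=> b; elim/Oq_ind=> c.
by rewrite -Oq_piD !Oq_piM -Oq_piD mulrDr.
Qed.

Lemma Oq_oner_neq0 : Oq_one != 0.
Proof.
apply: contra qmat_ideal1 => /eqP one0; rewrite -[1]subr0; apply/Oq_piP.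
by rewrite -/Oq_one one0 piE.
Qed.

HB.instance Definition _ := GRing.Zmodule_isNzRing.Build Oq
  Oq_mulA Oq_mul1r Oq_mulr1 Oq_mulDl Oq_mulDr Oq_oner_neq0.

Lemma Oq_scalerA c d a : Oq_scale c (Oq_scale d a) = Oq_scale (c * d) a.
Proof. by elim/Oq_ind: a => a; rewrite !Oq_piZ scalerA. Qed.

Lemma Oq_scale1r : left_id 1 Oq_scale.
Proof. by elim/Oq_ind=> a; rewrite Oq_piZ scale1r. Qed.

Lemma Oq_scalerDr : right_distributive Oq_scale +%R.
Proof.
move=> c; elim/Oq_ind=> a; elim/Oq_ind=> b.
by rewrite -Oq_piD !Oq_piZ -Oq_piD scalerDr.
Qed.

Lemma Oq_scalerDl a : {morph Oq_scale^~ a : c d / c + d}.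
Proof. by elim/Oq_ind: a => a c d; rewrite !Oq_piZ -Oq_piD scalerDl. Qed.

HB.instance Definition _ := GRing.Zmodule_isLmodule.Build k Oq
  Oq_scalerA Oq_scale1r Oq_scalerDr Oq_scalerDl.

Lemma Oq_scalerAl (c : k) (a b : Oq) : c *: (a * b) = (c *: a) * b.
Proof.
elim/Oq_ind: a => a; elim/Oq_ind: b => b.
rewrite [LHS](congr1 (Oq_scale c) (Oq_piM a b)) Oq_piZ.
by rewrite [RHS](congr1 (Oq_mul^~ (pi b)) (Oq_piZ c a)) Oq_piM scalerAl.
Qed.

HB.instance Definition _ := GRing.Lmodule_isLalgebra.Build k Oq Oq_scalerAl.

Lemma free_scalerAr (c : k) (a b : F) : c *: (a * b) = a * (c *: b).
Proof.
apply/malgP=> m; rewrite mcoeffZ !(@mcoeffMlw _ _ (msupp a) (msupp b)) //;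
  last exact: msuppZ_le.
rewrite mulr_sumr; apply: eq_bigr => u _; rewrite mulr_sumr.
by apply: eq_bigr => v _; rewrite mcoeffZ mulrnAr mulrCA.
Qed.

Lemma Oq_scalerAr (c : k) (a b : Oq) : c *: (a * b) = a * (c *: b).
Proof.
elim/Oq_ind: a => a; elim/Oq_ind: b => b.
rewrite [LHS](congr1 (Oq_scale c) (Oq_piM a b)) Oq_piZ.
by rewrite [RHS](congr1 (Oq_mul (pi a)) (Oq_piZ c b)) Oq_piM free_scalerAr.
Qed.

HB.instance Definition _ := GRing.Lalgebra_isAlgebra.Build k Oq Oq_scalerAr.

Definition Oq_gen (i j : 'I_n) : Oq := pi (x i j).

End QuantumMatrices.

Definition perm_length (t : nat) (s : 'S_t) : nat :=
  #|[set p : 'I_t * 'I_t | (p.1 < p.2)%N && (s p.2 < s p.1)%N]|.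

(* [I|J]; for a set of ordinals, enum_val lists the elements in increasing
   order, and the product over 'I_#|I| is taken in increasing order of a. *)
Definition qminor (k : fieldType) (n : nat) (q : k) (I J : {set 'I_n})
    (eqIJ : #|I| = #|J|) : Oq n q :=
  \sum_(s : 'S_#|I|)
     (- q) ^+ perm_length s *:
       \prod_(a < #|I|) Oq_gen q (enum_val a) (enum_val (cast_ord eqIJ (s a))).

(* 'I_n is {0, ..., n - 1} whereas indices are taken in {1, ..., n}. *)
Definition weight (n : nat) (I : {set 'I_n}) : nat := (\sum_(a in I) a.+1)%N.

Definition qtau (k : fieldType) (n : nat) (q : k) (i : nat) : Oq n q :=
  \sum_(I : {set 'I_n} | #|I| == i)
     q ^- (2 * weight I) *: qminor q (erefl #|I|).

Import mpoly.

(* Evaluation of p at y: each monomial 'X_0^m0 ... 'X_(r-1)^m(r-1) is sent to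
   the product of the y i ^+ m i in this order. *)
Definition alg_eval (k : fieldType) (A : algType k) (r : nat) (y : 'I_r -> A)
    (p : {mpoly k[r]}) : A :=
  mmap (in_alg A) y p.

Definition alg_independent (k : fieldType) (A : algType k) (r : nat)
    (y : 'I_r -> A) : Prop :=
  forall p : {mpoly k[r]}, alg_eval y p = 0 -> p = 0.

Definition polynomial_subalg (k : fieldType) (A : algType k) (r : nat)
    (y : 'I_r -> A) : Prop :=
  exists f : {lrmorphism {mpoly k[r]} -> A},
    [/\ forall i, f 'X_i = y i,
        injective f
      & forall a, subalg_gen (fun b => exists i, b = y i) a <->
                  exists p, f p = a].

(* Main.v *)
Require Import Defs.
From mathcomp Require Import all_boot all_order all_algebra.
From HB Require Import structures.
From mathcomp Require Import perm zify ring.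
From mathcomp Require monalg mpoly.

(** Let R_a be the standard R-matrix acting on V^(x)m in positions a, a+1, and
    let T = X (x) ... (x) X.  The defining relations of quantum matrices say
    that R_a T = T R_a.  A q-antisymmetric tensor is a common eigenvector of the
    R_a for the eigenvalue -q^-1, and the sum of the principal i x i quantum
    minors is the trace of T on those tensors in V^(x)i.  So
    sigma_i sigma_j is the trace of T on Lambda^i (x) Lambda^j inside
    V^(x)(i+j).  The braid that moves the first i strands past the last j
    commutes with T and maps this subspace onto Lambda^j (x) Lambda^i, whence
    sigma_i sigma_j = sigma_j sigma_i.  Rescaling row a of X by q^(-2a)
    preserves the relations and turns sigma_i into tau_i.

    For independence, kill the off-diagonal generators: the quotient is a
    polynomial ring, in which tau_i becomes, after rescaling the variables, the
    i-th elementary symmetric polynomial. *)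

Set Implicit Arguments.
Unset Strict Implicit.
Unset Printing Implicit Defensive.
Import Order.TTheory GRing.Theory.
Local Open Scope ring_scope.

(** * Braiding two blocks of strands *)

Section BlockBraid.
Variables (M : pzRingType) (m : nat) (R : nat -> M).
Hypothesis R_far : forall a b, (a.+1 < b)%N -> R a * R b = R b * R a.
Hypothesis R_braid : forall a, (a.+2 < m)%N ->
  R a * R a.+1 * R a = R a.+1 * R a * R a.+1.

(** The product R_a R_(a+1) ... R_(a+l-1), which carries one strand past [l] neighbours. *)
Fixpoint strand (a l : nat) : M :=
  if l is l'.+1 then strand a l' * R (a + l') else 1.

Fixpoint block_braid (i j : nat) : M :=
  if j is j'.+1 then strand j' i * block_braid i j' else 1.

Lemma strand_far_right a l c : (a + l < c)%N ->
  strand a l * R c = R c * strand a l.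
Proof.
elim: l => [|l IH] h /=; first by rewrite mul1r mulr1.
by rewrite -mulrA R_far ?mulrA ?IH //; lia.
Qed.

Lemma strand_far_left a l c : (c.+1 < a)%N ->
  strand a l * R c = R c * strand a l.
Proof.
move=> h; elim: l => [|l IH] /=; first by rewrite mul1r mulr1.
by rewrite -mulrA -R_far ?mulrA ?IH //; lia.
Qed.

(** [R b] commutes with the factors of large index until it meets R_b R_(b+1); the braid relation
    there turns it into [R b.+1], which commutes with the rest. *)
Lemma strand_shift a l b : (a <= b)%N -> (b.+1 < a + l)%N -> (a + l < m)%N ->
  strand a l * R b = R b.+1 * strand a l.
Proof.
elim: l => [|l IH] hab hbl hm /=; first by lia.
have [hlt|hge] := ltnP b.+1 (a + l).
  by rewrite -mulrA -R_far // !mulrA IH //; lia.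
case: l IH hbl hm hge => [|l] _ hbl hm hge /=; first by lia.
have -> : b = (a + l)%N by lia.
rewrite addnS -!mulrA (mulrA (R (a + l))) R_braid ?(mulrA (strand a l));
  last by lia.
by rewrite !mulrA strand_far_right.
Qed.

(** A crossing of two neighbouring strands slides through the [i] strands that both of them pass, by
    one braid relation for each. *)
Lemma strand_pair c i : (c + i < m.-1)%N ->
  strand c.+1 i * strand c i * R (c + i) = R c * (strand c.+1 i * strand c i).
Proof.
elim: i => [|i IH] h /=; first by rewrite !mul1r mulr1 addn0.
rewrite mulrA -!mulrA (mulrA (R _) (strand c i)) addSn.
rewrite -(@strand_far_right c i) ?leqnn // addnS.
have br : R (c + i).+1 * (R (c + i) * R (c + i).+1) =
          R (c + i) * (R (c + i).+1 * R (c + i)).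
  by rewrite !mulrA R_braid //; lia.
rewrite -(mulrA (strand c i)) br; rewrite !mulrA in IH *.
rewrite IH; last by lia.
by rewrite -!mulrA (mulrA (R _) (strand c i)) -strand_far_right // !mulrA.
Qed.

Lemma block_braid_far i j c : (i + j <= c)%N ->
  block_braid i j * R c = R c * block_braid i j.
Proof.
elim: j => [|j IH] h /=; first by rewrite mul1r mulr1.
by rewrite -mulrA IH ?mulrA ?strand_far_right //; lia.
Qed.

(** Each of the [j] crossing strands raises the index by one, by [strand_shift]. *)
Lemma block_braid_shift_left i j b : (b.+1 < i)%N -> (i + j <= m)%N ->
  block_braid i j * R b = R (b + j) * block_braid i j.
Proof.
move=> hb; elim: j => [|j IH] h /=; first by rewrite mul1r mulr1 addn0.
by rewrite -mulrA IH ?mulrA ?strand_shift ?addnS //; lia.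
Qed.

(** Only the two strands joined by the crossing matter, and [strand_pair] handles them; the others
    commute with it. *)
Lemma block_braid_shift_right i j c : (c.+1 < j)%N -> (i + j <= m)%N ->
  block_braid i j * R (i + c) = R c * block_braid i j.
Proof.
elim: j => [|j IH] hc h /=; first by lia.
have [hlt|hge] := ltnP c.+1 j.
  by rewrite -mulrA IH ?mulrA ?strand_far_left //; lia.
have -> : j = c.+1 by lia.
rewrite /= -!mulrA block_braid_far //.
by rewrite !(mulrA (strand _ _)) addnC [LHS]mulrA strand_pair ?mulrA //; lia.
Qed.

(** Applied to two properties: being invertible, and commuting with T. *)
Lemma block_braid_closed (S : M -> Prop) i j : S 1 ->
  (forall x y, S x -> S y -> S (x * y)) -> (forall a, S (R a)) ->
  S (block_braid i j).
Proof.
move=> S1 SM SR; have Ss a l : S (strand a l).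
  by elim: l => //= l IH; apply: SM.
by elim: j => //= j IH; apply: SM.
Qed.

End BlockBraid.

Lemma block_braid_unit (M : pzRingType) (R : nat -> M) i j :
  (forall a, exists v, R a * v = 1 /\ v * R a = 1) ->
  exists v, block_braid R i j * v = 1 /\ v * block_braid R i j = 1.
Proof.
pose invertible (x : M) := exists v, x * v = 1 /\ v * x = 1.
move=> SR; apply: (@block_braid_closed M R invertible) => //.
  by exists 1; rewrite mulr1.
move=> x y [v [xv vx]] [w [yw wy]]; exists (w * v); split.
  by rewrite mulrA -(mulrA x) yw mulr1.
by rewrite mulrA -(mulrA w) vx mulr1.
Qed.

(** * Traces with central coefficients *)

Section TraceConj.
Variables (A : nzRingType) (N : nat).
Implicit Types B M T P : 'M[A]_N.

(** The entries of T do not commute, so cyclicity of the trace is used only against matrices with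
    central entries. *)
Definition central_mx B := forall x y c, B x y * c = c * B x y.

Lemma central_mxM B C : central_mx B -> central_mx C -> central_mx (B * C).
Proof.
move=> hB hC x y c; rewrite mxE mulr_suml mulr_sumr.
by apply: eq_bigr => z _; rewrite -mulrA hC mulrA hB mulrA.
Qed.

Lemma central_mxtrC B M : central_mx B -> \tr (B * M) = \tr (M * B).
Proof.
move=> hB; rewrite /mxtrace.
under eq_bigr do rewrite mxE.
rewrite exchange_big /=; apply: eq_bigr => x _; rewrite mxE.
by apply: eq_bigr => y _; rewrite hB.
Qed.

(* [w * P * wi] and [P'] are projections with the same image, and the trace of
   [T] on an invariant subspace does not depend on the choice of projection. *)
Lemma mxtr_proj_conj T P P' w wi :
  central_mx P -> central_mx w -> central_mx wi ->
  w * wi = 1 -> wi * w = 1 -> w * T = T * w ->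
  P' * (w * P) = w * P -> P * (wi * P') = wi * P' -> P * (T * P) = T * P ->
  \tr (T * P) = \tr (T * P').
Proof.
move=> cP cw cwi ww1 ww2 wT e1 e2 e3.
set Q := w * P * wi.
have cQ : central_mx Q by do 2?apply: central_mxM.
have trQ : \tr (T * P) = \tr (T * Q).
  rewrite -[in LHS](mulr1 P) -ww2 !mulrA -central_mxtrC // !mulrA.
  by rewrite wT.
have P'Q : P' * Q = Q by rewrite /Q !mulrA -(mulrA P') e1.
have QP' : Q * P' = P' by rewrite /Q -!mulrA e2 mulrA ww1 mul1r.
have wiT : wi * T = T * wi.
  by rewrite -[LHS]mulr1 -ww1 !mulrA -(mulrA wi) -wT !mulrA ww2 mul1r.
have QTQ : Q * (T * Q) = T * Q.
  rewrite /Q -!mulrA (mulrA wi T) wiT -!mulrA (mulrA wi w) ww2 mul1r.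
  by rewrite (mulrA T P) (mulrA P) e3 -!mulrA !mulrA wT.
(* tr(T P' Q) = tr(Q T P') as Q is central, and Q T P' = Q T Q P' = T Q P' = T P'. *)
rewrite trQ -P'Q mulrA -central_mxtrC //; congr (\tr _).
by rewrite -QP' (mulrA T) [LHS]mulrA QTQ.
Qed.

End TraceConj.

(** * The R-matrix on words *)

Section Words.
Variable n : nat.
Implicit Types (w u v : seq 'I_n) (x y : 'I_n) (a i : nat).

Fixpoint wswap a w : seq 'I_n :=
  match a, w with
  | 0, x :: y :: s => y :: x :: s
  | a'.+1, x :: s => x :: wswap a' s
  | _, _ => w
  end.

Lemma size_wswap a w : size (wswap a w) = size w.
Proof. by elim: a w => [|a IH] [|x [|y w]] //=; rewrite IH. Qed.

Lemma wswapK a : involutive (wswap a).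
Proof. by elim: a => [|a IH] [|x [|y w]] //=; rewrite IH. Qed.

Lemma perm_wswap a w : perm_eq (wswap a w) w.
Proof.
elim: a w => [|a IH] [|x w] //=; last by rewrite perm_cons.
by case: w => [|y w] //=; rewrite -cat1s (perm_catCA [:: y] [:: x]).
Qed.

Lemma wswap_catl a u v : (a.+1 < size u)%N ->
  wswap a (u ++ v) = wswap a u ++ v.
Proof.
elim: a u => [|a IH] [|x u] //=; first by case: u.
by move=> h; rewrite IH.
Qed.

Lemma wswap_catr a u v : wswap (size u + a) (u ++ v) = u ++ wswap a v.
Proof. by elim: u => //= x u ->. Qed.

Lemma wswap_out a w : (size w <= a.+1)%N -> wswap a w = w.
Proof.
by elim: a w => [|a IH] [|x [|y w]] //= h; rewrite IH.
Qed.

Fixpoint inversions w : nat :=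
  if w is x :: s then (count (fun y : 'I_n => (y < x)%N) s + inversions s)%N
    else 0.

Variables (k : fieldType) (q : k).

(* The R-matrix of V (x) V is the flip plus the diagonal matrix with entries
   [rwt x y]; it has eigenvalues q and -q^-1. *)
Definition rwt x y : k :=
  if (x < y)%N then q - q^-1 else if (y < x)%N then 0 else q - 1.

(* 0 when [a.+1] is not a position of [w]; as [wswap a w = w] there too, the
   operator [rop a] is the identity out of range. *)
Fixpoint wcoef a w : k :=
  match a, w with
  | 0, x :: y :: _ => rwt x y
  | a'.+1, _ :: s => wcoef a' s
  | _, _ => 0
  end.

Lemma wcoef_out a w : (size w <= a.+1)%N -> wcoef a w = 0.
Proof. by elim: a w => [|a IH] [|x [|y w]] //= h; rewrite IH. Qed.

Lemma wcoef_catl a u v : (a.+1 < size u)%N -> wcoef a (u ++ v) = wcoef a u.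
Proof.
elim: a u => [|a IH] [|x u] //=; first by case: u.
by move=> h; rewrite IH.
Qed.

Lemma wcoef_catr a u v : wcoef (size u + a) (u ++ v) = wcoef a v.
Proof. by elim: u => //= x u ->. Qed.

Hypothesis q0 : q != 0.

Lemma wcoef_wswap a w : (a.+1 < size w)%N ->
  [\/ wcoef a w = q - q^-1 /\ wcoef a (wswap a w) = 0,
      wcoef a w = 0 /\ wcoef a (wswap a w) = q - q^-1 |
      wcoef a w = q - 1 /\ wswap a w = w].
Proof.
elim: a w => [|a IH] [|x w] //=; last first.
  move=> /(IH w) [] [e1 e2]; try by [constructor 1 | constructor 2].
  by constructor 3; rewrite e1 e2.
case: w => [|y w] //= _; rewrite /rwt; case: ltngtP => h; rewrite ?ltnn.
- by constructor 1.
- by constructor 2.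
- by constructor 3; split => //; rewrite (val_inj h).
Qed.

Section Operators.
Variables (B : nzRingType) (g : k -> B).
Implicit Types (f : seq 'I_n -> B).

Definition rop a f w : B := g (wcoef a w) * f w + f (wswap a w).

Lemma eq_rop a f f' m : (forall w, size w = m -> f w = f' w) ->
  forall w, size w = m -> rop a f w = rop a f' w.
Proof. by move=> e w hw; rewrite /rop !e // size_wswap. Qed.

End Operators.

Local Notation ropk := (@rop k id).

Lemma rop_far a b f w : (a.+1 < b)%N ->
  ropk a (ropk b f) w = ropk b (ropk a f) w.
Proof.
elim: a b f w => [|a IH] [|b] f [|x w] // h.
- by case: w => [|y w]; case: b h => // b h; rewrite /rop /=; ring.
- by have := IH b (fun s => f (x :: s)) w h; rewrite /rop.
Qed.

(** The Hecke relation (R - q)(R + q^-1) = 0, checked on the span of a word and its swap. *)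
Lemma rop_quad a f w : (a.+1 < size w)%N ->
  ropk a (ropk a f) w = (q - q^-1) * ropk a f w + f w.
Proof.
move=> h; rewrite /rop wswapK.
by case: (wcoef_wswap h) => [[-> ->]|[-> ->]|[e ->]]; rewrite ?e; field.
Qed.

(** Only three letters are involved, so this Yang-Baxter equation is a finite check over their
    relative orders. *)
Lemma rop_braid a f w : (a.+2 < size w)%N ->
  ropk a (ropk a.+1 (ropk a f)) w = ropk a.+1 (ropk a (ropk a.+1 f)) w.
Proof.
elim: a f w => [|a IH] f [|x w] // h; last first.
  by have := IH (fun s => f (x :: s)) w h; rewrite /rop.
case: w h => [|y [|z w]] // _; rewrite /rop /= /rwt.
case: (ltngtP x y) => [hxy|hxy|/val_inj hxy];
case: (ltngtP x z) => [hxz|hxz|/val_inj hxz];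
case: (ltngtP y z) => [hyz|hyz|/val_inj hyz]; subst; rewrite ?ltnn;
  try (exfalso; lia); by field.
Qed.

Lemma wcoef_inversions a w : (a.+1 < size w)%N ->
  [\/ wcoef a w = q - q^-1 /\ inversions (wswap a w) = (inversions w).+1,
      wcoef a w = 0 /\ inversions w = (inversions (wswap a w)).+1 |
      [/\ wcoef a w = q - 1, wswap a w = w & ~~ uniq w]].
Proof.
elim: a w => [|a IH] [|x w] //=; last first.
  have -> : count (fun y : 'I_n => (y < x)%N) (wswap a w) =
            count (fun y : 'I_n => (y < x)%N) w.
    exact/seq.permP/perm_wswap.
  move=> /(IH w) [[-> e]|[-> e]|[-> -> e]].
  - by constructor 1; rewrite e addnS.
  - by constructor 2; rewrite e addnS.
  - by constructor 3; rewrite (negbTE e) andbF.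
case: w => [|y w] //= _; rewrite /rwt; case: ltngtP => h; rewrite ?ltnn.
- by constructor 1; split => //; lia.
- by constructor 2; split => //; lia.
- by constructor 3; rewrite (val_inj h) inE eqxx.
Qed.

(** The case split for induction on inversions: a word that is not strictly increasing has a descent
    or two equal neighbours. *)
Lemma sorted_or_nonascent w : sorted <%O w \/
  exists2 a, (a.+1 < size w)%N &
    (wcoef a w = 0 /\ inversions w = (inversions (wswap a w)).+1) \/
    [/\ wcoef a w = q - 1, wswap a w = w & ~~ uniq w].
Proof.
elim: w => [|x [|y w] IH]; [by left|by left|].
have [hxy|hxy|hxy] := ltngtP x y; last 2 first.
- right; exists 0%N => //; left => /=; rewrite /rwt ltnNge (ltnW hxy) /= hxy.
  by split => //; lia.
- right; exists 0%N => //; right => /=; rewrite /rwt (val_inj hxy) ltnn.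
  by rewrite inE eqxx.
case: IH => [h|[a h [[e1 e2]|[e1 e2 e3]]]].
- by left; move: h; rewrite /= ltEord hxy.
- right; exists a.+1 => //; left; split => //.
  rewrite [LHS]/= -/(inversions (y :: w)) e2 addnS; congr (_ + _).+1.
  by rewrite [RHS](seq.permP (perm_wswap a (y :: w))).
- by right; exists a.+1 => //; right; split => //;
    [exact: (congr1 (cons x) e2) | rewrite cons_uniq (negbTE e3) andbF].
Qed.

(* Column [u] is nonzero for strictly increasing [u] only, and it is then the
   q-antisymmetrization of the word [u]. *)
Definition qasym v u : k :=
  if sorted <%O u && perm_eq v u then (- q) ^+ inversions v else 0.

(** At an ascent the swap multiplies the entry by -q, and (q - q^-1) - q = -q^-1; at a descent it
    divides the entry by -q. Equal neighbours cannot occur in a rearrangement of a strictly sorted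
    word. *)
Lemma rop_qasym a u v : (a.+1 < size v)%N ->
  ropk a (qasym^~ u) v = - q^-1 * qasym v u.
Proof.
move=> h; rewrite /rop /qasym (permPl (perm_wswap a v)).
case: andP => [[su pvu]|_]; last by rewrite !mulr0 addr0.
case: (wcoef_inversions h) => [[-> ->]|[-> ->]|[_ _]].
- by rewrite exprS; field.
- by rewrite exprS; field.
- by rewrite (perm_uniq pvu) lt_sorted_uniq.
Qed.

(** * q-antisymmetric functions on words *)

Section Antisymmetric.
Variables (B : nzRingType) (g : {rmorphism k -> B}) (l : nat).
Hypothesis q2 : q ^+ 2 + 1 != 0.
Variable f : seq 'I_n -> B.
Hypothesis f_asym : forall a w, (a.+1 < l)%N -> size w = l ->
  rop g a f w = g (- q^-1) * f w.

(** At a descent the eigenvalue equation expresses [f w] through a word with fewer inversions. At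
    equal neighbours it reads (q + q^-1) f(w) = 0, and q^2 + 1 != 0 forces f(w) = 0. *)
Lemma antisymmetric_sort w : size w = l ->
  f w = if uniq w then g ((- q) ^+ inversions w) * f (sort <=%O w) else 0.
Proof.
have [N] := ubnP (inversions w); elim: N w => // N IH w hN hw.
case: (sorted_or_nonascent w) => [sw|[a]].
  have := sw; rewrite lt_sorted_uniq_le => /andP[-> /sort_le_id->].
  suff -> : inversions w = 0%N by rewrite expr0 rmorph1 mul1r.
  move: sw; rewrite lt_sorted_pairwise; elim: w {hN hw} => //= x w IHw.
  case/andP => hx /IHw ->; rewrite addn0; apply/eqP;
    rewrite -leqn0 leqNgt -has_count.
  apply/hasP => -[y yw]; move/allP: hx => /(_ y yw); rewrite ltEord; lia.
rewrite hw => ha [[c0 e]|[c1 sw /negbTE->]]; have := f_asym ha hw.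
  rewrite /rop c0 rmorph0 mul0r add0r => fE; rewrite e ltnS in hN.
  have := IH _ hN; rewrite size_wswap => /(_ hw).
  rewrite (perm_uniq (perm_wswap a w)).
  have -> : sort <=%O (wswap a w) = sort <=%O w.
    by apply/perm_sort_leP; exact: perm_wswap.
  rewrite fE e => e2.
  have -> : f w = g (- q) * (g (- q^-1) * f w).
    by rewrite mulrA -rmorphM mulrNN mulfV // rmorph1 mul1r.
  by rewrite e2; case: uniq; rewrite ?mulr0 // exprS rmorphM mulrA.
rewrite /rop c1 sw => fE.
have : g (q + q^-1) * f w = 0.
  rewrite rmorphD mulrDl; apply/eqP.
  rewrite rmorphN mulNr in fE; rewrite addr_eq0 -fE rmorphB rmorph1 mulrBl
    mul1r subrK.
  by [].
have q' : q + q^-1 != 0.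
  apply: contra q2 => /eqP e; rewrite expr2 -(mulfV q0) -mulrDr e mulr0.
  by [].
move=> /(congr1 (fun z => g (q + q^-1)^-1 * z)).
by rewrite mulr0 mulrA -rmorphM mulVf // rmorph1 mul1r.
Qed.

(** The projection property of [qasym]: only the sorted rearrangement of [w] can contribute, and
    [antisymmetric_sort] evaluates its term. *)
Lemma qasym_antisymmetric w : size w = l ->
  \sum_(u : l.-tuple 'I_n) g (qasym w u) * f u = f w.
Proof.
move=> hw; have hs : size (sort <=%O w) == l by rewrite size_sort hw.
rewrite (bigD1 (Tuple hs)) //= big1 ?addr0 => [|u hu].
  rewrite /qasym sort_lt_sorted perm_sym perm_sort perm_refl andbT.
  rewrite [RHS]antisymmetric_sort //.
  by case: uniq; rewrite ?rmorph0 ?mul0r.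
rewrite /qasym; case: andP => [[su pu]|_]; last by rewrite rmorph0 mul0r.
case/eqP: hu; apply: val_inj => /=;
  rewrite (perm_sort_leP _ _ pu) sort_le_id //.
by move: su; rewrite lt_sorted_uniq_le => /andP[].
Qed.
End Antisymmetric.
End Words.

(** * Matrices indexed by words of fixed length *)

Section KernelMatrix.
Variables (n m : nat) (B : nzRingType).
Local Notation word := (m.-tuple 'I_n).
Local Notation N := #|{: word}|.
Implicit Types (K L : seq 'I_n -> seq 'I_n -> B) (X : 'M[B]_N) (y : 'I_N).

Definition kmx K : 'M[B]_N :=
  \matrix_(x < N, y < N) K (enum_val x : word) (enum_val y : word).

(** A column extended by 0 to words of every length, so that operators such as [rop] can act on
    it. *)
Definition kcol X y (w : seq 'I_n) : B :=
  if insub w is Some t then X (enum_rank (t : word)) y else 0.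

Lemma kcolE X y (t : word) : kcol X y t = X (enum_rank t) y.
Proof. by rewrite /kcol valK. Qed.

Lemma kcolP X X' :
  (forall y (w : seq 'I_n), size w = m -> kcol X y w = kcol X' y w) -> X = X'.
Proof.
move=> e; apply/matrixP => x y; have := e y (enum_val x : word) (size_tuple _).
by rewrite !kcolE enum_valK.
Qed.

Lemma kcol_kmx K y w : size w = m -> kcol (kmx K) y w = K w (enum_val y : word).
Proof.
by move/eqP=> hw; rewrite -[w]/(val (Tuple hw)) kcolE mxE enum_rankK.
Qed.

Lemma sum_enum_val (F : word -> B) :
  \sum_(x < N) F (enum_val x) = \sum_(t : word) F t.
Proof.
rewrite [RHS](reindex (@enum_val _ {: word})) /=; first exact: eq_bigl.
exact/onW_bij/enum_val_bij.
Qed.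

Lemma kcol_kmxM K X y w : size w = m ->
  kcol (kmx K * X) y w = \sum_(t : word) K w t * kcol X y t.
Proof.
move/eqP=> hw; rewrite -[w]/(val (Tuple hw)) kcolE mxE -sum_enum_val.
by apply: eq_bigr => x _; rewrite mxE enum_rankK kcolE enum_valK.
Qed.

Lemma kcolZ (c : B) X y w : kcol (c *: X) y w = c * kcol X y w.
Proof. by rewrite /kcol; case: insub => [t|]; rewrite ?mxE ?mulr0. Qed.

Lemma kcolD X X' y w : kcol (X + X') y w = kcol X y w + kcol X' y w.
Proof. by rewrite /kcol; case: insub => [t|]; rewrite ?mxE ?addr0. Qed.

Lemma mxtrace_kmxM K L :
  \tr (kmx K * kmx L) = \sum_(u : word) \sum_(v : word) K u v * L v u.
Proof.
rewrite /mxtrace -sum_enum_val; apply: eq_bigr => x _;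
  rewrite mxE -sum_enum_val.
by apply: eq_bigr => y _; rewrite !mxE.
Qed.

End KernelMatrix.

(** * Braid matrices and the generic quantum matrix *)

Section BraidMatrices.
Variables (n m : nat) (k : fieldType) (q : k).
Hypothesis q0 : q != 0.
Local Notation word := (m.-tuple 'I_n).
Local Notation N := #|{: word}|.

Definition rker a (u v : seq 'I_n) : k :=
  wcoef q a u *+ (u == v) + (v == wswap a u)%:R.

Lemma sum_rker (B : nzRingType) (g : {rmorphism k -> B}) a
    (f : seq 'I_n -> B) (w : seq 'I_n) : size w = m ->
  \sum_(t : word) g (rker a w t) * f t = rop q g a f w.
Proof.
move=> hw; under eq_bigr => t _ do
  rewrite /rker rmorphD !rmorphMn rmorph1 mulrDl !mulrnAl mul1r !mulrb.
rewrite big_split /= -!big_mkcond /=.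
have sz : size w == m by rewrite hw.
have sz' : size (wswap a w) == m by rewrite size_wswap hw.
rewrite (big_pred1 (Tuple sz)) => [|t]; last by rewrite /= eq_sym.
by rewrite (big_pred1 (Tuple sz')).
Qed.

(** The kernel is symmetric in its two words, because [wswap a] is an involution. *)
Lemma sum_rker_right (B : nzRingType) (g : {rmorphism k -> B}) a
    (f : seq 'I_n -> B) (w : seq 'I_n) : size w = m ->
    (forall c x, g c * x = x * g c) ->
  \sum_(t : word) f t * g (rker a t w) = rop q g a f w.
Proof.
move=> hw gC; rewrite -sum_rker //; apply: eq_bigr => t _.
rewrite -gC /rker; congr (g _ * _).
rewrite [t == w :> seq _]eq_sym; congr (_ + _).
  by case: eqP => // ->.
by rewrite eq_sym (inv_eq (@wswapK _ a)).
Qed.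

Definition rmx a : 'M[k]_N := kmx m (rker a).

Lemma kcol_rmxM (B : nzRingType) (g : {rmorphism k -> B}) a (X : 'M[B]_N)
    (y : 'I_N) (w : seq 'I_n) : size w = m ->
  kcol (map_mx g (rmx a) * X) y w = rop q g a (kcol X y) w.
Proof.
move=> hw; rewrite -sum_rker //.
have -> : map_mx g (rmx a) = kmx m (fun u v => g (rker a u v)).
  by apply/matrixP => x z; rewrite !mxE.
by rewrite kcol_kmxM.
Qed.

Lemma kcol_rmxMk a (X : 'M[k]_N) (y : 'I_N) (w : seq 'I_n) : size w = m ->
  kcol (rmx a * X) y w = rop q idfun a (kcol X y) w.
Proof. by move=> hw; rewrite -kcol_rmxM // map_mx_id. Qed.

Lemma kcol_rmxM2 a b (X : 'M[k]_N) (y : 'I_N) (w : seq 'I_n) : size w = m ->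
  kcol (rmx a * (rmx b * X)) y w = rop q idfun a (rop q idfun b (kcol X y)) w.
Proof.
move=> hw; rewrite kcol_rmxMk //; apply: eq_rop hw => u hu.
exact: kcol_rmxMk.
Qed.

Lemma kcol_rmxM3 a b c (X : 'M[k]_N) (y : 'I_N) (w : seq 'I_n) : size w = m ->
  kcol (rmx a * (rmx b * (rmx c * X))) y w =
  rop q idfun a (rop q idfun b (rop q idfun c (kcol X y))) w.
Proof.
move=> hw; rewrite kcol_rmxMk //; apply: eq_rop hw => u hu.
exact: kcol_rmxM2.
Qed.

Lemma rmx_far a b : (a.+1 < b)%N -> rmx a * rmx b = rmx b * rmx a.
Proof.
move=> h; rewrite -[LHS]mulr1 -[RHS]mulr1 -!mulrA; apply: kcolP => y w hw.
by rewrite !kcol_rmxM2 //; exact: rop_far.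
Qed.

Lemma rmx_braid a : (a.+2 < m)%N ->
  rmx a * rmx a.+1 * rmx a = rmx a.+1 * rmx a * rmx a.+1.
Proof.
move=> h; rewrite -[RHS]mulr1 -[LHS]mulr1 -!mulrA; apply: kcolP => y w hw.
by rewrite !kcol_rmxM3 //; apply: rop_braid; rewrite ?hw.
Qed.

Lemma rmx_quad a : (a.+1 < m)%N -> rmx a * rmx a = (q - q^-1) *: rmx a + 1.
Proof.
move=> h; rewrite -[LHS]mulr1 -[rmx a in RHS]mulr1 -mulrA;
  apply: kcolP => y w hw.
rewrite kcolD kcolZ kcol_rmxM2 // kcol_rmxMk //.
by apply: rop_quad; rewrite ?hw.
Qed.

Lemma rmx_out a : (m <= a.+1)%N -> rmx a = 1.
Proof.
move=> h; rewrite -[LHS]mulr1; apply: kcolP => y w hw.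
by rewrite kcol_rmxMk // /rop wcoef_out ?wswap_out ?hw // mul0r add0r.
Qed.

(** The Hecke relation gives the inverse R - (q - q^-1). *)
Lemma rmx_unit a : exists v, rmx a * v = 1 /\ v * rmx a = 1.
Proof.
have [h|h] := ltnP a.+1 m; last by exists 1; rewrite rmx_out ?mulr1.
exists (rmx a - (q - q^-1)%:M); have e := rmx_quad h.
rewrite mulrBr mulrBl e -[_ * _%:M]/(_ *m _%:M) -[_%:M * _]/(_%:M *m _).
by rewrite mul_mx_scalar mul_scalar_mx addrC addKr.
Qed.
End BraidMatrices.

(** * Quantum families and their tensor powers *)

Section QuantumFamily.
Variables (k : fieldType) (q : k) (n : nat) (A : algType k).
Variable Y : 'I_n -> 'I_n -> A.

Definition quantum_family : Prop :=
  [/\ forall i j l : 'I_n, (j < l)%N -> Y i j * Y i l = q *: (Y i l * Y i j),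
      forall i l j : 'I_n, (i < l)%N -> Y i j * Y l j = q *: (Y l j * Y i j),
      forall i j l m : 'I_n, (i < l)%N -> (m < j)%N ->
        Y i j * Y l m = Y l m * Y i j &
      forall i j l m : 'I_n, (i < l)%N -> (j < m)%N ->
        Y i j * Y l m - Y l m * Y i j = (q - q^-1) *: (Y i m * Y l j)].

(** The entry of Y (x) ... (x) Y in row [u] and column [v]; surplus letters of a longer word are
    ignored. *)
Fixpoint wmonomial (u v : seq 'I_n) : A :=
  match u, v with
  | x :: u', y :: v' => Y x y * wmonomial u' v'
  | _, _ => 1
  end.

Lemma wmonomial_cat u u' v v' : size u = size v ->
  wmonomial (u ++ u') (v ++ v') = wmonomial u v * wmonomial u' v'.
Proof.
elim: u v => [|x u IH] [|y v] //= => [_|[/IH->]]; first by rewrite mul1r.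
by rewrite mulrA.
Qed.

Hypotheses (q0 : q != 0) (famY : quantum_family).

(** All four families of relations at once, as an entry of R (Y (x) Y) = (Y (x) Y) R. The nine cases
    are the relative orders of the rows and of the columns. *)
Lemma quantum_family_rwt x x' y y' :
  rwt q x x' *: (Y x y * Y x' y') + Y x' y * Y x y' =
  rwt q y y' *: (Y x y * Y x' y') + Y x y' * Y x' y.
Proof.
case: famY => hrow hcol hcomm hcross; rewrite /rwt.
(* For two generators in one row or one column; both sides equal q a. *)
have aux (a b : A) : a = q *: b -> (q - q^-1) *: a + b = (q - 1) *: a + a.
  move=> ->; rewrite scalerBl scalerBl scale1r [q^-1 *: _]scalerA mulVf //
    scale1r.
  by rewrite !subrK.
case: (ltngtP x x') => [hx|hx|/val_inj hx];
case: (ltngtP y y') => [hy|hy|/val_inj hy]; subst; rewrite ?scale0r ?add0r.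
- by rewrite (hcomm x y' x' y).
- by rewrite -hcross // subrK.
- by apply: aux; apply: hcol.
- by rewrite -(hcomm x' y' x y) // -hcross // subrK.
- exact: hcomm.
- by rewrite hcol // scalerBl scale1r subrK.
- by rewrite aux //; apply: hrow.
- by rewrite (hrow x' y' y) // scalerBl scale1r subrK.
- by [].
Qed.

Lemma wmonomial_wswap a (u v : seq 'I_n) : size u = size v ->
  rop q (in_alg A) a (wmonomial^~ v) u = rop q (in_alg A) a (wmonomial u) v.
Proof.
rewrite /rop !mulr_algl.
elim: a u v => [|a IH] [|x u] [|y v] //= [h];
  last by rewrite !scalerAr -!mulrDr IH.
case: u v h => [|x' u] [|y' v] //= [h].
by rewrite !mulrA !(scalerAl _ (_ * _)) -!mulrDl quantum_family_rwt.
Qed.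

Variable m : nat.
Local Notation word := (m.-tuple 'I_n).
Local Notation N := #|{: word}|.
Local Notation R a := (map_mx (in_alg A) (rmx n m q a)).

Definition tmx : 'M[A]_N := kmx m wmonomial.

Lemma rmx_tmxC a : R a * tmx = tmx * R a.
Proof.
apply: kcolP => y w hw; rewrite kcol_rmxM // kcol_kmxM //.
have gC (c : k) (x : A) : in_alg A c * x = x * in_alg A c.
  by rewrite mulr_algl mulr_algr.
have szy : size (enum_val y : word) = m by rewrite size_tuple.
have -> : rop q (in_alg A) a (kcol tmx y) w =
          rop q (in_alg A) a (wmonomial^~ (enum_val y : word)) w.
  by apply: (@eq_rop _ _ _ _ _ _ _ _ m) => // u hu; rewrite kcol_kmx.
rewrite wmonomial_wswap ?hw // -(sum_rker_right (m := m)) //.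
apply: eq_bigr => t _; congr (_ * _).
by rewrite kcolE !mxE enum_rankK.
Qed.
End QuantumFamily.

Lemma sum_tuple_cat (B : nmodType) (T : finType) (i j m : nat)
    (F : seq T -> B) : (i + j)%N = m ->
  \sum_(t : m.-tuple T) F t =
  \sum_(u : i.-tuple T) \sum_(v : j.-tuple T) F (u ++ v).
Proof.
move=> <-; rewrite pair_bigA /=.
pose h (p : i.-tuple T * j.-tuple T) := cat_tuple p.1 p.2.
rewrite (reindex h) //; apply: onW_bij.
apply: inj_card_bij; last by rewrite card_prod !card_tuple expnD.
move=> [u v] [u' v'] /(congr1 val) /= /eqP.
rewrite eqseq_cat ?size_tuple // => /andP[/eqP e1 /eqP e2].
by congr pair; apply: val_inj.
Qed.

(** * Commutation of the sums of principal minors *)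

Section BlockProjection.
Variables (n m : nat) (k : fieldType) (q : k).
Hypotheses (q0 : q != 0) (q2 : q ^+ 2 + 1 != 0).
Local Notation word := (m.-tuple 'I_n).
Local Notation N := #|{: word}|.

(* Kernel of the projection of V^(x)m onto Lambda^i (x) Lambda^(m-i). *)
Definition pker i (v u : seq 'I_n) : k :=
  qasym q (take i v) (take i u) * qasym q (drop i v) (drop i u).

(** Since a + 1 differs from i, positions a and a + 1 lie in the same block, where [rop_qasym]
    applies. *)
Lemma rop_pker i a (u v : seq 'I_n) :
  (i <= m)%N -> size v = m -> (a.+1 < m)%N -> a.+1 != i ->
  rop q id a ((pker i)^~ u) v = - q^-1 * pker i v u.
Proof.
move=> him; rewrite -(cat_take_drop i v); set v1 := take i v;
  set v2 := drop i v.
rewrite size_cat => hv ha hai.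
have sv1 : size v1 = i.
  rewrite size_takel //; move: hv; rewrite -size_cat cat_take_drop => ->.
  exact: him.
have [hlt|hge] := ltnP a.+1 i.
  have h1 : (a.+1 < size v1)%N by rewrite sv1.
  rewrite /rop wcoef_catl // wswap_catl // /pker !take_size_cat ?size_wswap //.
  rewrite !drop_size_cat ?size_wswap //.
  by rewrite !mulrA -mulrDl -(rop_qasym q0 _ h1).
have [b hb] : exists b, a = (size v1 + b)%N by exists (a - i)%N; lia.
have h2 : (b.+1 < size v2)%N by lia.
rewrite hb /rop wcoef_catr wswap_catr /pker !take_size_cat // !drop_size_cat //.
rewrite mulrCA -mulrDr mulrCA; congr (_ * _).
exact: rop_qasym.
Qed.

(** [qasym_antisymmetric] is applied to the second block with the first one fixed, then to the first
    block. *)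
Lemma sum_pker (B : nzRingType) (g : {rmorphism k -> B}) i j
    (f : seq 'I_n -> B) : (i + j)%N = m ->
  (forall a w, (a.+1 < m)%N -> a.+1 != i -> size w = m ->
     rop q g a f w = g (- q^-1) * f w) ->
  forall w : seq 'I_n, size w = m ->
    \sum_(t : word) g (pker i w t) * f t = f w.
Proof.
move=> hij hf w hw.
rewrite (@sum_tuple_cat _ _ i j m (fun t => g (pker i w t) * f t)) //.
have s1 : size (take i w) = i by rewrite size_takel // hw; lia.
have s2 : size (drop i w) = j by rewrite size_drop hw; lia.
rewrite -[RHS](congr1 f (cat_take_drop i w)).
transitivity (\sum_(u : i.-tuple 'I_n)
    g (qasym q (take i w) u) * f (u ++ drop i w)).
  apply: eq_bigr => u _.
  under eq_bigr => v _ do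
    rewrite /pker take_size_cat ?size_tuple // drop_size_cat ?size_tuple //
      rmorphM -mulrA.
  rewrite -mulr_sumr; congr (_ * _).
  apply: (@qasym_antisymmetric _ _ q q0 _ g j q2 (fun v => f (u ++ v)))
    => // b v hb hv.
  have e : (i + b)%N = (size u + b)%N by rewrite size_tuple.
  have := hf (i + b)%N (u ++ v); rewrite /rop e wcoef_catr wswap_catr.
  by apply; rewrite ?size_cat size_tuple; lia.
apply: (@qasym_antisymmetric _ _ q q0 _ g i q2 (fun u => f (u ++ drop i w)))
  => // b u hb hu.
have := hf b (u ++ drop i w).
rewrite size_cat hu s2 /rop wcoef_catl ?hu // wswap_catl ?hu //.
by apply; lia.
Qed.

Definition pmx i : 'M[k]_N := kmx m (pker i).

Lemma rmx_pmx i a : (i <= m)%N -> (a.+1 < m)%N -> a.+1 != i ->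
  rmx n m q a * pmx i = (- q^-1)%:M * pmx i.
Proof.
move=> hi ha hai; rewrite -[_%:M * _]/(_ *m _) mul_scalar_mx.
apply: kcolP => y w hw; rewrite kcolZ kcol_rmxMk // kcol_kmx //.
rewrite -(@rop_pker i a) //.
by apply: (@eq_rop _ _ _ _ _ _ _ _ m) => // u hu; rewrite kcol_kmx.
Qed.

(** Reduces the three inclusions of images required by [mxtr_proj_conj] to eigenvector equations. *)
Lemma pmx_fix (B : nzRingType) (g : {rmorphism k -> B}) i (X : 'M[B]_N) :
  (i <= m)%N ->
  (forall a, (a.+1 < m)%N -> a.+1 != i ->
     map_mx g (rmx n m q a) * X = (g (- q^-1))%:M * X) ->
  map_mx g (pmx i) * X = X.
Proof.
move=> hi hX; apply: kcolP => y w hw.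
have -> : map_mx g (pmx i) = kmx m (fun u v => g (pker i u v)).
  by apply/matrixP => x z; rewrite !mxE.
rewrite kcol_kmxM //; apply: (@sum_pker _ g i (m - i)) => // [|a u ha hai hu].
  by lia.
by rewrite -kcol_rmxM // hX // -[_%:M * _]/(_ *m _) mul_scalar_mx kcolZ.
Qed.

End BlockProjection.

Section Commutation.
Variables (n : nat) (k : fieldType) (q : k) (A : algType k).
Variable Y : 'I_n -> 'I_n -> A.
Hypotheses (q0 : q != 0) (q2 : q ^+ 2 + 1 != 0) (famY : quantum_family q Y).

(** The trace of T on the q-antisymmetric tensors of V^(x)l. *)
Definition qsigma l : A :=
  \sum_(u : l.-tuple 'I_n) \sum_(v : l.-tuple 'I_n)
     qasym q v u *: wmonomial Y u v.

Local Notation g := (in_alg A).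

(** Both T and the block projection factor over concatenation of words, so the trace is a
    product. *)
Lemma qsigmaM i j m : (i + j)%N = m ->
  \tr (tmx Y m * map_mx g (pmx n m q i)) = qsigma i * qsigma j.
Proof.
move=> hm.
have -> : map_mx g (pmx n m q i) = kmx m (fun u v => g (pker q i u v)).
  by apply/matrixP => x z; rewrite !mxE.
rewrite mxtrace_kmxM.
rewrite (@sum_tuple_cat _ _ i j m (fun u => \sum_(v : m.-tuple 'I_n)
   wmonomial Y u v * g (pker q i v u))) //.
rewrite /qsigma mulr_suml; apply: eq_bigr => u _.
under eq_bigr => u' _ do rewrite (@sum_tuple_cat _ _ i j m (fun v =>
   wmonomial Y (u ++ u') v * g (pker q i v (u ++ u')))) //.
rewrite exchange_big mulr_suml /=; apply: eq_bigr => v _.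
rewrite mulr_sumr; apply: eq_bigr => u' _.
rewrite mulr_sumr; apply: eq_bigr => v' _.
rewrite wmonomial_cat ?size_tuple // mulr_algr /pker.
rewrite !take_size_cat ?size_tuple // !drop_size_cat ?size_tuple //.
by rewrite -scalerA -scalerAr -scalerAl scalerA mulrC scalerA.
Qed.

Lemma central_map_alg (N : nat) (X : 'M[k]_N) : central_mx (map_mx g X).
Proof. by move=> x y c; rewrite mxE mulr_algl mulr_algr. Qed.

Theorem qsigma_comm i j : qsigma i * qsigma j = qsigma j * qsigma i.
Proof.
pose m := (i + j)%N.
rewrite -(@qsigmaM i j m) // -(@qsigmaM j i m) 1?addnC //.
pose r a := rmx n m q a; pose R a := map_mx g (r a).
have far a b : (a.+1 < b)%N -> r a * r b = r b * r a by exact: rmx_far.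
have braid a : (a.+2 < m)%N -> r a * r a.+1 * r a = r a.+1 * r a * r a.+1.
  exact: rmx_braid.
pose w := block_braid r i j.
have [wi [w1 w2]] : exists wi, w * wi = 1 /\ wi * w = 1.
  by apply: block_braid_unit => a; exact: rmx_unit.
pose P := map_mx g (pmx n m q i); pose P' := map_mx g (pmx n m q j).
pose L : 'M[A]_#|{: m.-tuple 'I_n}| := (g (- q^-1))%:M.
pose W := map_mx g w; pose Wi := map_mx g wi; pose T := tmx Y m.
have mapM X X' : map_mx g (X * X') = map_mx g X * map_mx g X'.
  exact: map_mxM.
have LC X : X * L = L * X.
  rewrite -[X * L]/(X *m L) -[L * X]/(L *m X) /L mul_scalar_mx.
  apply/matrixP => x y; rewrite !mxE (bigD1 y) //= big1 => [|z hz].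
    by rewrite mxE eqxx mulr1n addr0 mulr_algl mulr_algr.
  by rewrite mxE (negbTE hz) mulr0n mulr0.
have RP a : (a.+1 < m)%N -> a.+1 != i -> R a * P = L * P.
  move=> h1 h2; rewrite -mapM rmx_pmx ?leq_addr // mapM; congr (_ * _).
  exact: map_scalar_mx.
have RP' a : (a.+1 < m)%N -> a.+1 != j -> R a * P' = L * P'.
  move=> h1 h2; rewrite -mapM rmx_pmx ?leq_addl // mapM; congr (_ * _).
  exact: map_scalar_mx.
have RT a : R a * T = T * R a by exact: rmx_tmxC.
have WT : W * T = T * W.
  apply: (@block_braid_closed _ r (fun x => map_mx g x * T = T * map_mx g x)).
  - by rewrite map_mx1 mulr1 mul1r.
  - by move=> x y hx hy; rewrite mapM -mulrA hy mulrA hx mulrA.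
  - exact: RT.
have W1 : W * Wi = 1 by rewrite -mapM w1 map_mx1.
have W2 : Wi * W = 1 by rewrite -mapM w2 map_mx1.
(* The braid matches crossings inside a block of sizes (j, i) with crossings inside a block of sizes
   (i, j). *)
have shift a : (a.+1 < m)%N -> a.+1 != j ->
    exists b, [/\ (b.+1 < m)%N, b.+1 != i & R a * W = W * R b].
  move=> h1 h2; have [hlt|hge] := ltnP a.+1 j.
    exists (i + a)%N; split; [by rewrite /m; lia|lia|].
    by rewrite -!mapM /w (block_braid_shift_right far braid).
  exists (a - j)%N; split; [by rewrite /m; lia|rewrite /m in h1; lia|].
  rewrite -!mapM /w (block_braid_shift_left far braid) //;
    last by rewrite /m in h1; lia.
  by rewrite subnK //; lia.
(* The same for the inverse braid, obtained by conjugating W R_a = R_b W. *)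
have shift' a : (a.+1 < m)%N -> a.+1 != i ->
    exists b, [/\ (b.+1 < m)%N, b.+1 != j & R a * Wi = Wi * R b].
  move=> h1 h2.
  have [b [hb1 hb2 e]] :
      exists b, [/\ (b.+1 < m)%N, b.+1 != j & W * R a = R b * W].
    have [hlt|hge] := ltnP a.+1 i.
      exists (a + j)%N; split; [by rewrite /m; lia|lia|].
      by rewrite -!mapM /w (block_braid_shift_left far braid).
    exists (a - i)%N; split;
      [by rewrite /m in h1 *; lia|rewrite /m in h1; lia|].
    rewrite -!mapM /w -(block_braid_shift_right far braid) //;
      last by rewrite /m in h1; lia.
    by rewrite subnKC //; lia.
  exists b; split => //.
  by rewrite -[LHS]mul1r -W2 -!mulrA (mulrA W) e -!mulrA W1 mulr1.
apply: (@mxtr_proj_conj _ _ T P P' W Wi) => //; try exact: central_map_alg.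
- apply: pmx_fix; rewrite ?leq_addl // => a h1 h2.
  have [b [hb1 hb2 e]] := shift a h1 h2.
  by rewrite -/(R a) mulrA e -mulrA RP // !mulrA LC.
- apply: pmx_fix; rewrite ?leq_addr // => a h1 h2.
  have [b [hb1 hb2 e]] := shift' a h1 h2.
  by rewrite -/(R a) mulrA e -mulrA RP' // !mulrA LC.
- apply: pmx_fix; rewrite ?leq_addr // => a h1 h2.
  by rewrite -/(R a) mulrA RT -mulrA RP // !mulrA LC.
Qed.
End Commutation.

(** * Principal minors as sums over words *)

Section Link.
Variable n : nat.

Lemma inversions_nth (w : seq 'I_n) :
  inversions w = (\sum_(i < size w) \sum_(j < size w)
    ((i < j) && (nth 0 (map val w) j < nth 0 (map val w) i)))%N.
Proof.
elim: w => [|x w IH] /=; first by rewrite big_ord0.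
rewrite big_ord_recl big_ord_recl /= add0n; congr (_ + _)%N.
  rewrite -sum1_count (big_nth x) big_mkord big_mkcond /=.
  by apply: eq_bigr => i _; rewrite add0n (nth_map x) //; case: ifP.
rewrite IH; apply: eq_bigr => i _; rewrite big_ord_recl /= add0n.
by apply: eq_bigr => j _.
Qed.

(** A strictly increasing [u] preserves and reflects the order of positions. *)
Lemma perm_length_inversions (l : nat) (u : l.-tuple 'I_n) (s : 'S_l) :
  sorted <%O u -> perm_length s = inversions [tuple tnth u (s a) | a < l].
Proof.
move=> su; rewrite inversions_nth size_tuple pair_bigA /=.
rewrite /perm_length -sum1_card big_mkcond /=; apply: eq_bigr => -[i j] _.
rewrite !inE /=.
have nthE (a : 'I_l) :
    nth 0%N (map val [tuple tnth u (s a) | a < l]) a = tnth u (s a).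
  rewrite (nth_map (tnth u a)) ?size_tuple // -tnth_nth.
  by rewrite tnth_mktuple.
rewrite !nthE.
have -> : (tnth u (s j) < tnth u (s i))%N = (s j < s i)%N.
  transitivity (tnth u (s j) < tnth u (s i))%O; first by rewrite ltEord.
  have x0 : 'I_n := tnth u i.
  by rewrite !(tnth_nth x0) (lt_sorted_ltn_nth x0 su) ?inE ?size_tuple.
by case: ifP.
Qed.

Variables (k : fieldType) (q : k) (A : algType k) (Y : 'I_n -> 'I_n -> A).

Lemma wmonomial_prod (l : nat) (u v : l.-tuple 'I_n) :
  wmonomial Y u v = \prod_(a < l) Y (tnth u a) (tnth v a).
Proof.
elim: l u v => [|l IH] u v; first by rewrite big_ord0 (tuple0 u) (tuple0 v).
case/tupleP: u => x u; case/tupleP: v => y v.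
rewrite big_ord_recl /= !tnth0 IH; congr (_ * _).
by apply: eq_bigr => a _; rewrite !tnthS.
Qed.

(** Only rearrangements of [u] contribute, and permutations index them bijectively because the
    letters of [u] are distinct. *)
Lemma sum_qasym (l : nat) (u : l.-tuple 'I_n) : sorted <%O u ->
  \sum_(v : l.-tuple 'I_n) qasym q v u *: wmonomial Y u v =
  \sum_(s : 'S_l) (- q) ^+ perm_length s *:
     \prod_(a < l) Y (tnth u a) (tnth u (s a)).
Proof.
move=> su.
pose h (s : 'S_l) := [tuple tnth u (s a) | a < l].
have ih : injective h.
  move=> s t /(congr1 (fun v => tnth v)) e; apply/permP => a.
  have := congr1 (fun f => f a) e; rewrite !tnth_mktuple => /eqP.
  have x0 : 'I_n := tnth u a.
  rewrite !(tnth_nth x0) nth_uniq ?size_tuple ?lt_sorted_uniq //.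
  by move/eqP/val_inj.
rewrite (bigID (fun v => v \in h @: setT)) /= [X in _ + X]big1 ?addr0
  => [|v hv].
  rewrite big_imset; last by move=> s t _ _; exact: ih.
  apply: eq_big => [s|s _]; first by rewrite inE.
  rewrite /qasym su (perm_length_inversions s su) wmonomial_prod.
  have -> : perm_eq (h s) u by apply/tuple_permP; exists s.
  by congr (_ *: _); apply: eq_bigr => a _; rewrite tnth_mktuple.
rewrite /qasym; case: andP => [[_ /tuple_permP[s e]]|_];
  last by rewrite scale0r.
case/negP: hv; apply/imsetP; exists s => //.
exact: val_inj.
Qed.

(** Identifies the trace with the sum of principal minors: only strictly increasing words [u]
    contribute, and these are the subsets of size [l]. *)
Lemma qsigma_sets l :
  qsigma q Y l = \sum_(I : {set 'I_n} | #|I| == l)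
    \sum_(s : 'S_#|I|) (- q) ^+ perm_length s *:
      \prod_(a < #|I|) Y (enum_val a) (enum_val (s a)).
Proof.
rewrite /qsigma.
have -> : \sum_(u : l.-tuple 'I_n) \sum_(v : l.-tuple 'I_n)
     qasym q v u *: wmonomial Y u v =
   \sum_(u : l.-tuple 'I_n | sorted <%O u) \sum_(v : l.-tuple 'I_n)
     qasym q v u *: wmonomial Y u v.
  rewrite [RHS]big_mkcond; apply: eq_bigr => u _; case: ifP => // su.
  by rewrite big1 // => v _; rewrite /qasym su scale0r.
rewrite (partition_big (fun u : l.-tuple 'I_n => [set x in u])
  (fun I => #|I| == l)) /=; last first.
  move=> u su; rewrite cardsE; have /card_uniqP -> := lt_sorted_uniq su.
  by rewrite size_tuple.
apply: eq_bigr => I /eqP hI; subst l.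
have sI : sorted <%O (enum I).
  rewrite /enum_mem; apply: lt_sorted_filter; rewrite -enumT.
  have := iota_ltn_sorted 0 n; rewrite -val_enum_ord sorted_map.
  by apply: sub_sorted => x y; rewrite /= ltEord.
rewrite (big_pred1 (enum_tuple I)) => [|u] /=.
  rewrite sum_qasym //; apply: eq_bigr => s _; congr (_ *: _).
  apply: eq_bigr => a _; congr (Y _ _); rewrite (tnth_nth (enum_val a)) /=.
    exact/esym/enum_val_nth.
  exact/esym/enum_val_nth.
apply/andP/eqP => [[su /eqP hu]|->].
  apply/val_inj/lt_sorted_eq => //= x.
  by rewrite mem_enum; have /setP/(_ x) := hu; rewrite inE.
by split => //; apply/eqP/setP => x; rewrite inE mem_enum.
Qed.
End Link.

Lemma lrmorphism_of (k : nzRingType) (A B : algType k) (f : A -> B) :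
  (forall a b, f (a + b) = f a + f b) -> (forall c a, f (c *: a) = c *: f a) ->
  f 1 = 1 -> (forall a b, f (a * b) = f a * f b) ->
  exists g : {lrmorphism A -> B}, g =1 f.
Proof.
move=> fD fZ f1 fM.
have f0 : f 0 = 0 by apply: (addrI (f 0)); rewrite -fD !addr0.
pose L := GRing.isNmodMorphism.Build A B f (conj f0 fD).
pose Z := GRing.isScalable.Build k A B *:%R f fZ.
pose M := GRing.isMonoidMorphism.Build A B f (conj f1 fM).
pose g : {lrmorphism A -> B} := HB.pack f L Z M.
by exists g.
Qed.

(** * The universal property of quantum matrices *)

Section QuantumMatrixAlgebra.
Variables (k : fieldType) (n : nat) (q : k).
Local Notation F := (free_alg k n).
Local Notation x := (@free_gen k n).
Local Notation O := (Oq n q).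
Local Notation X := (@Oq_gen k n q).

Definition Oq_pi (a : F) : O := (\pi_(Quotient.quot (@qmat_ideal k n q)) a)%qT.

Lemma Oq_piB a b : Oq_pi (a - b) = Oq_pi a - Oq_pi b.
Proof.
have := Oq_piD q (a - b) b; rewrite subrK -/(Oq_pi a) -/(Oq_pi b) => ->.
by rewrite addrK.
Qed.

Lemma Oq_piMm a b : Oq_pi (a * b) = Oq_pi a * Oq_pi b.
Proof. exact: esym (Oq_piM q a b). Qed.

Lemma Oq_piZm c a : Oq_pi (c *: a) = c *: Oq_pi a.
Proof. exact: esym (Oq_piZ q c a). Qed.

Lemma Oq_pi_ideal r : ideal_gen (qmat_rel q) r -> Oq_pi r = 0.
Proof.
move=> hr; have e : Oq_pi r = Oq_pi 0.
  by apply/Oq_piP; rewrite subr0; apply/qmat_idealP.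
by rewrite e -(subrr 0) Oq_piB subrr.
Qed.

Lemma Oq_rel r : qmat_rel q r -> Oq_pi r = 0.
Proof.
move=> hr; apply: Oq_pi_ideal; rewrite -[r]mul1r -[_ * r]mulr1.
exact: ideal_genM.
Qed.

Lemma Oq_piMB a b c d :
  Oq_pi (a * b - c * d) = Oq_pi a * Oq_pi b - Oq_pi c * Oq_pi d.
Proof.
exact: etrans (Oq_piB _ _)
  (congr2 (fun u v => u - v) (Oq_piMm _ _) (Oq_piMm _ _)).
Qed.

Lemma Oq_piZM e a b : Oq_pi (e *: (a * b)) = e *: (Oq_pi a * Oq_pi b).
Proof. exact: etrans (Oq_piZm _ _) (congr1 _ (Oq_piMm _ _)). Qed.

Lemma Oq_piMBZ a b e c d :
  Oq_pi (a * b - e *: (c * d)) = Oq_pi a * Oq_pi b - e *: (Oq_pi c * Oq_pi d).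
Proof.
exact: etrans (Oq_piB _ _)
  (congr2 (fun u v => u - v) (Oq_piMm _ _) (Oq_piZM _ _ _)).
Qed.

Lemma quantum_family_Oq_gen : quantum_family q X.
Proof.
split=> [i j l h|i l j h|i j l m h h'|i j l m h h']; apply: subr0_eq.
- exact: etrans (esym (Oq_piMBZ _ _ _ _ _)) (Oq_rel (qmat_row q i h)).
- exact: etrans (esym (Oq_piMBZ _ _ _ _ _)) (Oq_rel (qmat_col q j h)).
- exact: etrans (esym (Oq_piMB _ _ _ _)) (Oq_rel (qmat_comm q h h')).
- apply: etrans (Oq_rel (qmat_cross q h h')); apply: etrans (esym (Oq_piB _ _)).
  exact: (congr2 (fun u v => u - v)
    (esym (Oq_piMB _ _ _ _)) (esym (Oq_piZM _ _ _))).
Qed.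

Section Lift.
Import monalg.
Variables (A : algType k) (Y : 'I_n -> 'I_n -> A).
Hypothesis famY : quantum_family q Y.

Definition monom_eval (m : fmonom ('I_n * 'I_n)%type) : A :=
  \prod_(p <- fmonom_val m) Y p.1 p.2.

Lemma monom_eval_mmorphism : mmorphism monom_eval.
Proof.
split=> [a b|]; rewrite /monom_eval ?fm1 ?big_nil //.
by rewrite fmM big_cat.
Qed.

HB.instance Definition _ :=
  isMultiplicative.Build (fmonom ('I_n * 'I_n)%type) A
    monom_eval monom_eval_mmorphism.

Definition free_eval (a : F) : A := mmap (in_alg A) monom_eval a.

Lemma free_evalD a b : free_eval (a + b) = free_eval a + free_eval b.
Proof. exact: mmapD. Qed.

Lemma free_evalB a b : free_eval (a - b) = free_eval a - free_eval b.
Proof. exact: mmapB. Qed.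

Lemma free_evalZ c a : free_eval (c *: a) = c *: free_eval a.
Proof.
have e := @mmapZ _ _ _ (in_alg A) monom_eval c a.
have e2 := mulr_algl c (free_eval a).
exact: etrans e e2.
Qed.

Lemma free_eval_multiplicative :
  free_eval 1 = 1 /\ forall a b, free_eval (a * b) = free_eval a * free_eval b.
Proof.
have gC (a : F) m m' :
    GRing.comm (in_alg A (mcoeff m a)) (monom_eval m').
  by rewrite /GRing.comm mulr_algl mulr_algr.
by have [hM h1] := @commr_mmap_is_multiplicative _ _ _ (in_alg A) monom_eval gC.
Qed.

Lemma free_eval_gen i j : free_eval (x i j) = Y i j.
Proof.
rewrite /free_eval /free_gen mmapU mulr_algl scale1r /monom_eval fmuE.
by rewrite big_seq1.
Qed.

Lemma free_eval_ideal a : ideal_gen (qmat_rel q) a -> free_eval a = 0.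
Proof.
have [h1 hM] := free_eval_multiplicative.
case: famY => hrow hcol hcomm hcross.
elim=> [|u v _ hu _ hv|b r d].
- by rewrite -(subrr 0) free_evalB subrr.
- by rewrite free_evalD hu hv addr0.
rewrite !hM => hr; suff -> : free_eval r = 0 by rewrite mulr0 mul0r.
have eM i j l m : free_eval (x i j * x l m) = Y i j * Y l m.
  exact: etrans (hM _ _) (congr2 *%R (free_eval_gen i j) (free_eval_gen l m)).
have eZ c i j l m : free_eval (c *: (x i j * x l m)) = c *: (Y i j * Y l m).
  exact: etrans (free_evalZ _ _) (congr1 _ (eM i j l m)).
have eB s t u v : free_eval s = u -> free_eval t = v -> u = v ->
    free_eval (s - t) = 0.
  by move=> <- <- e; apply: etrans (free_evalB _ _) _; rewrite e subrr.
case: hr => [i j l h|i l j h|i j l m h h'|i j l m h h'].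
- exact: eB (eM _ _ _ _) (eZ _ _ _ _ _) (hrow _ _ _ h).
- exact: eB (eM _ _ _ _) (eZ _ _ _ _ _) (hcol _ _ _ h).
- exact: eB (eM _ _ _ _) (eM _ _ _ _) (hcomm _ _ _ _ h h').
- apply: eB _ (eZ _ _ _ _ _) (hcross _ _ _ _ h h').
  exact: etrans (free_evalB _ _)
    (congr2 (fun u v => u - v) (eM _ _ _ _) (eM _ _ _ _)).
Qed.

Definition Oq_lift (a : O) : A := free_eval (repr a).

(** The chosen representative does not matter, because [free_eval] vanishes on the ideal. *)
Lemma Oq_lift_pi a : Oq_lift (Oq_pi a) = free_eval a.
Proof.
apply/subr0_eq; rewrite -free_evalB; apply: free_eval_ideal.
by apply/qmat_idealP; exact: Oq_repr.
Qed.

Lemma Oq_pi_surj (a : O) : exists b, a = Oq_pi b.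
Proof. by elim/Oq_ind: a => b; exists b. Qed.

Lemma Oq_lift_lrmorphism :
  [/\ forall a b, Oq_lift (a + b) = Oq_lift a + Oq_lift b,
      forall c a, Oq_lift (c *: a) = c *: Oq_lift a, Oq_lift 1 = 1 &
      forall a b, Oq_lift (a * b) = Oq_lift a * Oq_lift b].
Proof.
have [h1 hM] := free_eval_multiplicative.
split=> [a b|c a||a b]; first 1 last.
- by have [b ->] := Oq_pi_surj a; rewrite -Oq_piZm !Oq_lift_pi free_evalZ.
- by rewrite -h1; exact: Oq_lift_pi.
- have [u ->] := Oq_pi_surj a; have [v ->] := Oq_pi_surj b.
  by rewrite -Oq_piMm !Oq_lift_pi hM.
have [u ->] := Oq_pi_surj a; have [v ->] := Oq_pi_surj b.
apply: etrans (congr1 Oq_lift (esym (Oq_piD q u v))) _.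
apply: etrans (Oq_lift_pi _) (etrans (free_evalD _ _) _).
exact: (congr2 +%R (esym (Oq_lift_pi u)) (esym (Oq_lift_pi v))).
Qed.

Lemma Oq_lift_gen i j : Oq_lift (X i j) = Y i j.
Proof. by rewrite [LHS]Oq_lift_pi free_eval_gen. Qed.
End Lift.

Lemma Oq_lift_exists (A : algType k) (Y : 'I_n -> 'I_n -> A) :
  quantum_family q Y ->
  exists f : {lrmorphism O -> A}, forall i j, f (X i j) = Y i j.
Proof.
move=> famY; have [hD hZ h1 hM] := Oq_lift_lrmorphism famY.
have [f fE] := lrmorphism_of hD hZ h1 hM.
by exists f => i j; rewrite fE Oq_lift_gen.
Qed.
End QuantumMatrixAlgebra.

(** * Rescaling the rows of a quantum family *)

Section RowScaling.
Variables (k : fieldType) (q : k) (n : nat) (A : algType k).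
Variables (d : 'I_n -> k) (Y : 'I_n -> 'I_n -> A).

(** All terms of a relation use the same two rows, so they acquire the same scalar. *)
Lemma quantum_family_scale :
  quantum_family q Y -> quantum_family q (fun i j => d i *: Y i j).
Proof.
have sM a b (u v : A) : (a *: u) * (b *: v) = (a * b) *: (u * v).
  by rewrite -scalerAl -scalerAr scalerA.
case=> hrow hcol hcomm hcross.
split=> [i j l h|i l j h|i j l m h h'|i j l m h h'].
- by rewrite !sM hrow // !scalerA mulrC.
- by rewrite !sM hcol // !scalerA mulrC [d l * d i]mulrC.
- by rewrite !sM hcomm // [d l * d i]mulrC.
- by rewrite !sM [d l * d i]mulrC -scalerBr hcross // !scalerA mulrC.
Qed.
End RowScaling.

(** * The weighted sums tau_i *)

Section Tau.
Variables (k : fieldType) (q : k) (n : nat).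
Hypothesis q0 : q != 0.

Lemma prod_weight (c : k) (I : {set 'I_n}) :
  \prod_(a < #|I|) c ^+ (2 * (enum_val a).+1) = c ^+ (2 * weight I).
Proof.
rewrite -(big_enum_val (fun a : 'I_n => c ^+ (2 * a.+1))) /= /weight.
by rewrite big_distrr -expr_sum.
Qed.

(** Every term of [I|I] uses each row of I once, so the row factors multiply to q^(-2 w(I)); the
    successor makes the indices start from 1. *)
Lemma qtau_qsigma i :
  qtau n q i = qsigma q (fun a b => q ^- (2 * a.+1) *: Oq_gen q a b) i.
Proof.
rewrite qsigma_sets /qtau; apply: eq_bigr => I _.
rewrite /qminor scaler_sumr; apply: eq_bigr => s _.
have -> : \prod_(a < #|I|) (q ^- (2 * (enum_val a).+1) *:
      Oq_gen q (enum_val a) (enum_val (s a))) =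
    q ^- (2 * weight I) *:
      \prod_(a < #|I|)
        Oq_gen q (enum_val a) (enum_val (cast_ord (erefl #|I|) (s a))).
  rewrite scaler_prod; under eq_bigr do rewrite -exprVn.
  rewrite prod_weight exprVn; apply: (congr1 (fun z => _ *: z)).
  by apply: eq_bigr => a _; rewrite cast_ord_id.
by rewrite !scalerA [X in X *: _ = _]mulrC.
Qed.

Lemma qtau_comm i j : q ^+ 2 + 1 != 0 ->
  qtau n q i * qtau n q j = qtau n q j * qtau n q i.
Proof.
move=> q2; pose d (a : 'I_n) := q ^- (2 * a.+1).
have fam := quantum_family_scale d (quantum_family_Oq_gen n q).
rewrite (qtau_qsigma i) (qtau_qsigma j).
exact: (qsigma_comm q0 q2 fam i j).
Qed.

(** * Restriction to the diagonal *)

Import mpoly.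
(** The powers of q are chosen to cancel the weights q^(-2 w(I)) in tau. *)
Definition diag_family (i j : 'I_n) : {mpoly k[n]} :=
  if i == j then q ^+ (2 * i.+1) *: 'X_i else 0.

(** The target is commutative, so it suffices that every product with coefficient q or q - q^-1
    contains an off-diagonal generator. *)
Lemma quantum_family_diag : quantum_family q diag_family.
Proof.
rewrite /diag_family; split=> [i j l h|i l j h|i j l m h h'|i j l m h h'].
- case: eqP => [e|_]; case: eqP => [e'|_]; rewrite ?(mulr0, mul0r, scaler0) //.
  by exfalso; subst; lia.
- case: eqP => [e|_]; case: eqP => [e'|_]; rewrite ?(mulr0, mul0r, scaler0) //.
  by exfalso; subst; lia.
- exact: mulrC.
- rewrite [X in X - _]mulrC subrr.
  case: eqP => [e|_]; case: eqP => [e'|_]; rewrite ?(mulr0, mul0r, scaler0) //.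
  by exfalso; subst; lia.
Qed.

(** Only the identity permutation survives; any other moves an index and yields an off-diagonal
    factor. *)
Lemma minor_diag (f : {lrmorphism Oq n q -> {mpoly k[n]}}) (I : {set 'I_n}) :
  (forall a b, f (Oq_gen q a b) = diag_family a b) ->
  f (qminor q (erefl #|I|)) = q ^+ (2 * weight I) *: \prod_(a in I) 'X_a.
Proof.
move=> fE.
have fs (s : 'S_#|I|) :
    f ((- q) ^+ perm_length s *: \prod_(a < #|I|)
       Oq_gen q (enum_val a) (enum_val (cast_ord (erefl #|I|) (s a)))) =
    (- q) ^+ perm_length s *:
       \prod_(a < #|I|) diag_family (enum_val a) (enum_val (s a)).
  rewrite linearZ rmorph_prod; apply: (congr1 (fun z => _ *: z)).
  by apply: eq_bigr => a _; rewrite cast_ord_id; exact: fE.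
rewrite /qminor linear_sum; apply: etrans (eq_bigr _ (fun s _ => fs s)) _.
rewrite (bigD1 (1%g : 'S_#|I|)) //= [X in _ + X]big1 => [|s hs].
  rewrite addr0.
  have -> : perm_length (1%g : 'S_#|I|) = 0%N.
    apply/eqP; rewrite cards_eq0; apply/eqP/setP => -[a b];
      rewrite !inE !perm1 /=.
    by case: ltngtP.
  rewrite expr0 scale1r.
  under eq_bigr => a _ do rewrite perm1 /diag_family eqxx.
  rewrite scaler_prod prod_weight; congr (_ *: _).
  by rewrite -(big_enum_val (fun a : 'I_n => 'X_a : {mpoly k[n]})).
have [a ha] : exists a, s a != a.
  apply/existsP; apply: contraR hs => /existsPn h; apply/eqP/permP => a.
  by rewrite perm1; apply/eqP; have := h a; rewrite negbK.
rewrite (bigD1 a) //= /diag_family (inj_eq enum_val_inj).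
by rewrite eq_sym (negbTE ha) mul0r scaler0.
Qed.

Lemma qtau_mesym (f : {lrmorphism Oq n q -> {mpoly k[n]}}) i :
  (forall a b, f (Oq_gen q a b) = diag_family a b) ->
  f (qtau n q i) = mesym n k i.
Proof.
move=> fE; rewrite /qtau linear_sum /mesym; apply: eq_bigr => I _.
rewrite linearZ; apply: etrans (congr1 (fun z => _ *: z) (minor_diag I fE)) _.
by rewrite scalerA mulVf ?scale1r // expf_neq0.
Qed.

Lemma qtau_independent : alg_independent (fun i : 'I_n => qtau n q i.+1).
Proof.
move=> p; rewrite /alg_eval => e.
have [f fE] := Oq_lift_exists quantum_family_diag.
(* [f] turns the relation into [p] evaluated at the elementary symmetric polynomials, which are
   algebraically independent. *)
apply: msym_fundamental_un0.
have := congr1 f e; rewrite linear0 => <-.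
rewrite /comp_mpoly /mmap linear_sum; apply: eq_bigr => m _.
have fZ c u : f (in_alg (Oq n q) c * u) = c *: f u by rewrite mulr_algl linearZ.
apply: etrans (esym (fZ _ _)); rewrite mul_mpolyC;
  apply: (congr1 (fun z => _ *: z)).
rewrite /mmap1 rmorph_prod; apply: eq_bigr => i _;
  rewrite rmorphXn tnth_mktuple.
exact: (congr1 (fun z => z ^+ _) (esym (qtau_mesym _ fE))).
Qed.

End Tau.

(** * Polynomial evaluation at commuting elements *)

Section CommutingEvaluation.
Import mpoly.
Variables (k : fieldType) (A : algType k) (r : nat) (y : 'I_r -> A).
Hypothesis y_comm : forall i j, y i * y j = y j * y i.

(* The library's [commr_mmap1_M] asks that [y i] commute with all of [A]. *)
Lemma mmap1M m1 m2 : mmap1 y (m1 + m2)%MM = mmap1 y m1 * mmap1 y m2.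
Proof.
rewrite /mmap1; under eq_bigr => i _ do rewrite mnmDE exprD.
(* The commutation is carried along the induction in order to move the next power of [y i] past the
   partial product of [m1]. *)
suff [] : \prod_(i < r) (y i ^+ m1 i * y i ^+ m2 i) =
    (\prod_(i < r) y i ^+ m1 i) * (\prod_(i < r) y i ^+ m2 i) /\
    forall j, GRing.comm (\prod_(i < r) y i ^+ m1 i) (y j) by [].
elim/big_rec3: _ => [|i u v w _ [-> cw]].
  by split=> [|j]; [rewrite mulr1 | exact: commr_sym (commr1 _)].
split=> [|j].
  rewrite -!mulrA; congr (_ * _); rewrite !mulrA; congr (_ * _).
  exact: esym (commrX _ (cw i)).
apply: commr_sym; apply: commrM; last exact: commr_sym.
exact: commrX (y_comm _ _).
Qed.

Lemma alg_evalZ c p : alg_eval y (c *: p) = c *: alg_eval y p.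
Proof. by rewrite /alg_eval mmapZ [LHS]mulr_algl. Qed.

Lemma alg_evalM p p' : alg_eval y (p * p') = alg_eval y p * alg_eval y p'.
Proof.
have eXX c m d m' : alg_eval y ((c *: 'X_[m]) * (d *: 'X_[m'])) =
    in_alg A c * mmap1 y m * (in_alg A d * mmap1 y m').
  rewrite -scalerAl -scalerAr -mpolyXD !alg_evalZ /alg_eval mmapX mmap1M
    !mulr_algl.
  by rewrite -scalerAl -scalerAr.
rewrite /alg_eval {1}(mpolyE p) mulr_suml raddf_sum [X in _ = X * _]/mmap
  mulr_suml.
apply: eq_bigr => m _.
rewrite {1}(mpolyE p') mulr_sumr raddf_sum [X in _ = _ * X]/mmap mulr_sumr.
by apply: eq_bigr => m' _; exact: eXX.
Qed.

Lemma alg_eval_lrmorphism :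
  exists f : {lrmorphism {mpoly k[r]} -> A}, f =1 alg_eval y.
Proof.
apply: lrmorphism_of.
- by move=> a b; exact: mmapD.
- exact: alg_evalZ.
- by rewrite /alg_eval -[1]/(1%:MP) mmapC /= scale1r.
- exact: alg_evalM.
Qed.

Lemma subalg_gen_alg_eval a :
  subalg_gen (fun b => exists i, b = y i) a <-> exists p, alg_eval y p = a.
Proof.
split=> [|[p <-]].
  elim=> [_ [i ->]|c|u v _ [p <-] _ [p' <-]|u v _ [p <-] _ [p' <-]].
  - by exists 'X_i; rewrite /alg_eval mmapX mmap1U.
  - by exists c%:MP; rewrite /alg_eval mmapC.
  - by exists (p + p'); exact: mmapD.
  - by exists (p * p'); exact: alg_evalM.
have s0 : subalg_gen (fun b => exists i, b = y i) 0.
  by rewrite -(scale0r 1); exact: subalg_gen_scalar.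
have s1 : subalg_gen (fun b => exists i, b = y i) 1.
  by rewrite -(scale1r 1); exact: subalg_gen_scalar.
rewrite /alg_eval /mmap; apply: big_ind => // [u v|m _];
  first exact: subalg_genD.
apply: subalg_genM; first exact: subalg_gen_scalar.
rewrite /mmap1; apply: big_ind => // [u v|i _]; first exact: subalg_genM.
elim: (m i) => [|e IH]; first by rewrite expr0.
by rewrite exprS; apply: subalg_genM => //; apply: subalg_gen_in; exists i.
Qed.

Lemma polynomial_subalg_alg_independent :
  alg_independent y -> polynomial_subalg y.
Proof.
move=> indep; have [f fE] := alg_eval_lrmorphism; exists f; split.
- by move=> i; rewrite fE /alg_eval mmapX mmap1U.
- move=> p p' e; apply: subr0_eq; apply: indep.
  by rewrite -fE raddfB /= e subrr.
- move=> a; rewrite subalg_gen_alg_eval.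
  by split=> -[p e]; exists p; rewrite -e fE.
Qed.

End CommutingEvaluation.

(** Otherwise q is a root of X^2 + 1. The inequality says that the eigenvalues q and -q^-1 of R are
    distinct. *)
Lemma transcendental_sqr_add1 (k : fieldType) (q : k) :
  ~ algebraicOver (ratr : rat -> k) q -> q ^+ 2 + 1 != 0.
Proof.
move=> tr; apply/eqP => e; apply: tr; exists ('X^2 + 1).
  by rewrite -size_poly_eq0 size_polyDl ?size_polyXn ?size_poly1.
rewrite /root /map_poly horner_poly size_polyDl ?size_polyXn ?size_poly1 //.
rewrite !big_ord_recl big_ord0 /= !coefD !coefXn !coef1 /= !add0r !addr0.
have [r0 r1] : ratr 0 = 0 :> k /\ ratr 1 = 1 :> k.
  by rewrite !(ratr_nat _ 0, ratr_nat _ 1).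
by rewrite r0 r1 expr0 !mul1r mul0r add0r addrC e.
Qed.

Theorem mainTheorem5 (k : fieldType) (q : k) (n : nat)
    (char0 : [pchar k] =i pred0)
    (q_neq0 : q != 0)
    (q_transc : ~ algebraicOver (ratr : rat -> k) q)
    (n_gt0 : (0 < n)%N) :
  let tau := fun i : 'I_n => qtau n q i.+1 in
  [/\ polynomial_subalg tau,
      forall i j : 'I_n, tau i * tau j = tau j * tau i
    & alg_independent tau].
Proof.
have q2 := transcendental_sqr_add1 q_transc.
have comm (i j : 'I_n) :
    qtau n q i.+1 * qtau n q j.+1 = qtau n q j.+1 * qtau n q i.+1.
  exact: qtau_comm.
have indep := @qtau_independent k q n q_neq0.
split; [exact: polynomial_subalg_alg_independent | exact: comm | exact: indep].
Qed.
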